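(* Let $\Gamma$ be a strongly connected regular digraph with at least one nonreal eigenvalue. If $\Gamma$ is strongly $\ell$-walk-regular for infinitely many $\ell$, then one of the following cases holds: (i) $\Gamma$ is a doubly regular tournament; (ii) for every $\ell>1$ for which $\Gamma$ is strongly $\ell$-walk-regular, with parameters $(\lambda_\ell,\mu_\ell,\nu_\ell)$, we have $\mu_\ell=\lambda_\ell$ or $\mu_\ell=\nu_\ell$; (iii) $\Gamma$ is $k$-regular with four distinct eigenvalues $k$, $\rho e^{i\varphi}$, $\rho e^{-i\varphi}$, and $\theta$, where $\theta$ is real and $0<|\theta|<\rho\le k$.
   Context: All digraphs are finite and simple: a digraph is a pair $(V,E)$ with $V$ a finite nonempty set of vertices and $E$ a set of ordered pairs of distinct vertices (no loops, no multiple edges; both $uv$ and $vu$ may be edges). A vertex $u$ is adjacent to $v$ if $uv\in E$. The adjacency matrix $A$ has $A_{uv}=1$ if $u$ is adjacent to $v$ and $0$ otherwise; eigenvalues of $\Gamma$ are the (complex) eigenvalues of $A$. $\Gamma$ is $k$-regular if all vertices have both indegree and outdegree $k$, and regular if it is $k$-regular for some $k$. $\Gamma$ is strongly connected if there is a walk from every vertex to every other vertex. For an integer $\ell>1$, $\Gamma$ is strongly $\ell$-walk-regular with parameters $(\lambda_\ell,\mu_\ell,\nu_\ell)$ if the number of walks of length $\ell$ from $u$ to $v$ (that is, $(A^\ell)_{uv}$) equals $\lambda_\ell$ whenever $u$ is adjacent to $v$, $\mu_\ell$ whenever $u\neq v$ and $u$ is not adjacent to $v$, and $\nu_\ell$ whenever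 $u=v$. A doubly regular tournament is a regular digraph whose adjacency matrix satisfies $A+A^{\top}=J-I$ and $A^2=\lambda A+\mu(J-I-A)$ for some numbers $\lambda,\mu$, where $J$ is the all-ones matrix (that is, a strongly regular digraph with $t=0$). *)

(* Defs.v *)
From mathcomp Require Import all_boot all_order all_algebra.
From mathcomp Require Import classical_sets cardinality reals trigo complex.

Set Implicit Arguments.
Unset Strict Implicit.
Unset Printing Implicit Defensive.

Import Order.TTheory GRing.Theory Num.Theory.
Local Open Scope ring_scope.
Local Open Scope complex_scope.

Record digraph := Digraph {
  vertex : finType;
  edge : rel vertex;
  vertex_nonempty : (0 < #|vertex|)%N;
  edge_irrefl : irreflexive edge }.

(* Rows and columns follow the enumeration of the vertices: the entry for the
   pair (u, v) is adjmx K G (enum_rank u) (enum_rank v). *)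
Definition adjmx (K : pzSemiRingType) (G : digraph) : 'M[K]_#|vertex G| :=
  \matrix_(i, j) (edge (enum_val i : vertex G) (enum_val j))%:R.

Definition k_regular (G : digraph) (k : nat) : Prop :=
  forall v : vertex G,
    #|[set u | edge u v]| = k /\ #|[set w | edge v w]| = k.

Definition regular (G : digraph) : Prop := exists k, k_regular G k.

Definition strongly_connected (G : digraph) : Prop :=
  forall u v : vertex G, connect (@edge G) u v.

(* A walk of length l from u is given by its l vertices after u. *)
Definition nwalks (G : digraph) (l : nat) (u v : vertex G) : nat :=
  #|[set p : l.-tuple (vertex G) | path (@edge G) u p && (last u p == v)]|.

Lemma nwalksE (K : pzSemiRingType) (G : digraph) l (u v : vertex G) :
  (nwalks l u v)%:R = (adjmx K G ^+ l) (enum_rank u) (enum_rank v).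
Proof.
elim: l u => [|l IHl] u.
  rewrite expr0 mxE /nwalks (inj_eq enum_rank_inj); congr (_%:R).
  case: (eqVneq u v) => [->|uv].
    by rewrite -[RHS](cards1 (nil_tuple (vertex G))); apply: eq_card => p;
      rewrite [p]tuple0 !inE /= !eqxx.
  by apply: eq_card0 => p; rewrite [p]tuple0 !inE /= (negbTE uv).
rewrite exprS mxE (reindex_onto enum_rank enum_val) /=; last first.
  by move=> i _; rewrite enum_valK.
rewrite (eq_bigl predT) => [|w]; last by rewrite enum_rankK eqxx.
under eq_bigr => w _ do rewrite -IHl mxE !enum_rankK -natrM.
rewrite -natr_sum; congr (_%:R); rewrite /nwalks.
rewrite -sum1_card (partition_big (fun p : l.+1.-tuple _ => thead p) predT) //=.
apply: eq_bigr => w _.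
rewrite -sum1_card big_distrr /=.
rewrite (reindex_onto (fun q : l.-tuple _ => [tuple of w :: q])
          (fun p => [tuple of behead p])) /=; last first.
  by move=> p /andP[_ /eqP <-]; rewrite -tuple_eta.
rewrite big_mkcond [RHS]big_mkcond /=; apply: eq_bigr => q _.
have -> : [tuple of behead [tuple of w :: q]] = q by apply: val_inj.
rewrite !inE theadE !eqxx !andbT /= muln1 -andbA.
by case: (edge u w) => /=; case: ifP.
Qed.

Definition swr_params (G : digraph) (l lambda mu nu : nat) : Prop :=
  forall u v : vertex G,
    [/\ edge u v -> nwalks l u v = lambda,
        u != v -> ~~ edge u v -> nwalks l u v = mu
      & u = v -> nwalks l u v = nu].

Definition strongly_walk_regular (G : digraph) (l : nat) : Prop :=
  (1 < l)%N /\ exists lambda mu nu, swr_params G l lambda mu nu.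

Definition doubly_regular_tournament (G : digraph) : Prop :=
  let A := adjmx int G in
  let J := const_mx 1 : 'M[int]_#|vertex G| in
  [/\ regular G,
      A + A^T = J - 1%:M
    & exists lambda mu : int, A ^+ 2 = lambda *: A + mu *: (J - 1%:M - A)].

(* mathcomp's eigenvalue refers to row eigenvectors; a square matrix has the
   same eigenvalues on either side. *)
Definition is_eigenvalue (R : realType) (G : digraph) (z : R[i]) : Prop :=
  eigenvalue (adjmx R[i] G) z.

(* e^{i phi} *)
Definition expi (R : realType) (phi : R) : R[i] := cos phi +i* sin phi.

(* Main.v *)
(* Let E be the set of eigenvalues other than the degree k. If the digraph is
   strongly l-walk-regular, then z^l = a z + b for all z in E, where
   a = lambda - mu and b = nu - mu. So for z1 <> z2 in E, Lagrange interpolation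
   expresses z3^l in terms of z1^l and z2^l for any z3 in E; letting l grow, no
   two elements of E have modulus smaller than that of a third. If (ii) fails,
   some l has a b <> 0, and then the elements of E of a given modulus lie on the
   intersection of two circles centred at distinct real points, so they form at
   most one conjugate pair. Hence E is {z, z^*} or {z, z^*, theta} with
   |theta| < |z|; the latter is (iii). In the former, nonreal roots of the
   trinomial X^l - a X - b being simple, A^2 - (z + z^* ) A + z z^* I is a
   multiple of J. The projection onto the z-eigenspace has integral trace, which
   gives (z + z^* ) (n - 1) = - 2 k, and counting 2-walks then forces n = 2 k + 1
   and the absence of digons. *)
Require Import Defs.
From mathcomp Require Import all_boot all_order all_algebra.
From mathcomp Require Import boolp classical_sets cardinality reals trigo complex.
From mathcomp Require Import zify ring lra.

Set Implicit Arguments.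
Unset Strict Implicit.
Unset Printing Implicit Defensive.

Import Order.TTheory GRing.Theory Num.Theory.
Local Open Scope ring_scope.
Local Open Scope complex_scope.

(** * Walk counts and the all-ones matrix *)

Lemma swr_adjmx_exp (K : pzRingType) (G : digraph) (l lambda mu nu : nat) :
  swr_params G l lambda mu nu ->
  adjmx K G ^+ l = (lambda%:R - mu%:R) *: adjmx K G + mu%:R *: const_mx 1
    + (nu%:R - mu%:R) *: 1%:M.
Proof.
move=> swr; apply/matrixP => i j.
rewrite -(enum_valK i) -(enum_valK j) -nwalksE !mxE !enum_rankK mulr1.
rewrite (inj_eq enum_rank_inj).
have [le me ne] := swr (enum_val i) (enum_val j).
case: eqVneq => [ij|nij]; last case: (boolP (edge _ _)) => [eij|neij].
- by rewrite ne // -ij edge_irrefl mulr0 add0r mulr1 addrCA subrr addr0.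
- by rewrite le // mulr1 mulr0 addr0 subrK.
- by rewrite me // !mulr0 addr0 add0r.
Qed.

Lemma mulmx_adjmx (K : pzSemiRingType) (G : digraph) m (x : 'M[K]_(m, _))
    (v : vertex G) i :
  (x *m adjmx K G) i (enum_rank v) = \sum_(u | edge u v) x i (enum_rank u).
Proof.
rewrite mxE (reindex_onto enum_rank enum_val) /=; last first.
  by move=> j _; rewrite enum_valK.
rewrite big_mkcond [RHS]big_mkcond; apply: eq_bigr => u _.
by rewrite enum_rankK eqxx mxE !enum_rankK; case: edge; rewrite (mulr1, mulr0).
Qed.

Lemma adjmx_mulmx (K : pzSemiRingType) (G : digraph) m (x : 'M[K]_(_, m))
    (u : vertex G) j :
  (adjmx K G *m x) (enum_rank u) j = \sum_(v | edge u v) x (enum_rank v) j.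
Proof.
rewrite mxE (reindex_onto enum_rank enum_val) /=; last first.
  by move=> i _; rewrite enum_valK.
rewrite big_mkcond [RHS]big_mkcond; apply: eq_bigr => v _.
by rewrite enum_rankK eqxx mxE !enum_rankK; case: edge; rewrite (mul1r, mul0r).
Qed.

Lemma const_mul_adjmx (K : pzSemiRingType) (G : digraph) k m :
  k_regular G k ->
  (const_mx 1 : 'M[K]_(m, _)) *m adjmx K G = const_mx k%:R.
Proof.
move=> reg; apply/matrixP => i j; rewrite -(enum_valK j) mulmx_adjmx mxE.
rewrite (eq_bigr (fun=> 1)); last by move=> u _; rewrite mxE.
by rewrite -(reg (enum_val j)).1 sumr_const cardsE.
Qed.

Lemma adjmx_mul_const (K : pzSemiRingType) (G : digraph) k m :
  k_regular G k ->
  adjmx K G *m (const_mx 1 : 'M[K]_(_, m)) = const_mx k%:R.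
Proof.
move=> reg; apply/matrixP => i j; rewrite -(enum_valK i) adjmx_mulmx mxE.
rewrite (eq_bigr (fun=> 1)); last by move=> u _; rewrite mxE.
by rewrite -(reg (enum_val i)).2 sumr_const cardsE.
Qed.

(** * Eigenvalues other than the degree *)

(* Maximum principle: such an [f] is constant on the in-neighbourhood of each
   of its maxima. *)
Lemma harmonic_const (R : realDomainType) (G : digraph) k (f : vertex G -> R) :
  strongly_connected G -> k_regular G k ->
  (forall v, \sum_(u | edge u v) f u = k%:R * f v) -> forall u v, f u = f v.
Proof.
move=> sc reg harm.
have /card_gt0P[v0 _] := vertex_nonempty G.
have [m _ fm] := @arg_maxP _ _ _ v0 xpredT f isT.
suff const u : f u = f m by move=> u v; rewrite !const.
have /connectP[p] := sc u m.
elim: p u => [|w p IHp] u /= => [_ -> //|/andP[euw wp] mE].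
have fw := IHp w wp mE.
have : \sum_(u | edge u w) (f m - f u) = 0.
  rewrite sumrB harm fw sumr_const -[in RHS](subrr (k%:R * f m)).
  by rewrite -(reg w).1 cardsE mulr_natl.
move=> /eqP; rewrite psumr_eq0 => [/allP/(_ u)|x _]; last first.
  by rewrite subr_ge0; exact: fm.
by rewrite mem_index_enum euw subr_eq0 => /(_ isT)/eqP.
Qed.

(** Evaluate at a vertex maximising [|f|] and apply the triangle inequality to its [k]
    in-neighbours. *)
Lemma eigen_modulus_le (R : numDomainType) (G : digraph) k z
    (f : vertex G -> R) v0 :
  k_regular G k -> f v0 != 0 ->
  (forall v, \sum_(u | edge u v) f u = z * f v) -> `|z| <= k%:R.
Proof.
move=> reg f0 eig.
have [m _ fm'] := @real_arg_maxP _ _ v0 xpredT (fun u => `|f u|) isT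
  (fun u _ => normr_real (f u)).
have fm u : `|f u| <= `|f m| := fm' u isT.
have fm0 : 0 < `|f m| by rewrite (lt_le_trans _ (fm v0)) ?normr_gt0.
rewrite -(ler_pM2r fm0) -normrM -eig (le_trans (ler_norm_sum _ _ _)) //.
rewrite (le_trans (ler_sum _ (fun u _ => fm u))) // sumr_const.
by rewrite -(reg m).1 cardsE mulr_natl.
Qed.

(** The set E of the overview when the digraph is strongly connected and regular. Asking for an
    eigenvector whose entries sum to zero makes the [J] term vanish in every matrix identity. *)
Definition perp_eigenvalue (R : realType) (G : digraph) (z : R[i]) : Prop :=
  exists x : 'rV[R[i]]_#|vertex G|,
    [/\ x != 0, x *m adjmx _ G = z *: x & x *m const_mx 1 = 0 :> 'rV_#|vertex G|].

Lemma harmonic_const_complex (R : realType) (G : digraph) k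
    (f : vertex G -> R[i]) :
  strongly_connected G -> k_regular G k ->
  (forall v, \sum_(u | edge u v) f u = k%:R * f v) -> forall u v, f u = f v.
Proof.
move=> sc reg harm u v.
have ReD : {morph (@complex.Re R) : x y / x + y >-> x + y} by move=> [? ?] [? ?].
have ImD : {morph (@complex.Im R) : x y / x + y >-> x + y} by move=> [? ?] [? ?].
have kE : k%:R = k%:R%:C :> R[i] by rewrite rmorph_nat.
apply/eqP; rewrite eq_complex; apply/andP; split; apply/eqP.
- apply: (@harmonic_const _ G k (fun w => complex.Re (f w))) => // w.
  rewrite -(big_morph _ ReD (erefl : complex.Re (0 : R[i]) = 0)) harm kE.
  by case: (f w) => a b /=; rewrite mul0r subr0.
- apply: (@harmonic_const _ G k (fun w => complex.Im (f w))) => // w.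
  rewrite -(big_morph _ ImD (erefl : complex.Im (0 : R[i]) = 0)) harm kE.
  by case: (f w) => a b /=; rewrite mul0r addr0.
Qed.

(** An eigenvector for [k] is constant by the maximum principle, so zero entry sum would make it
    null. Conversely, computing [x A 1] in two ways gives [(z - k) (x 1) = 0]. *)
Lemma perp_eigenvalueP (R : realType) (G : digraph) k (z : R[i]) :
  strongly_connected G -> k_regular G k ->
  perp_eigenvalue G z <-> is_eigenvalue G z /\ z != k%:R.
Proof.
move=> sc reg; split=> [[x [x0 xA x1]]|[/eigenvalueP[x xA x0] zk]].
- split; first by apply/eigenvalueP; exists x.
  apply: contraNneq x0 => zk; rewrite zk in xA.
  have xc : forall u v : vertex G,
      x 0 (enum_rank u) = x 0 (enum_rank v).
    apply: (harmonic_const_complex sc reg) => v.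
    by rewrite -mulmx_adjmx xA mxE.
  apply/eqP/matrixP => i j; rewrite ord1 -(enum_valK j) !mxE.
  move/matrixP/(_ 0 j): x1; rewrite !mxE.
  rewrite (eq_bigr (fun=> x 0 (enum_rank (enum_val j)))); last first.
    by move=> i' _; rewrite mxE mulr1 -[in LHS](enum_valK i'); apply: xc.
  rewrite sumr_const card_ord => /eqP; rewrite mulrn_eq0.
  by rewrite (gtn_eqF (vertex_nonempty G)) => /eqP.
- exists x; split=> //.
  have : x *m adjmx R[i] G *m const_mx 1
      = k%:R *: (x *m const_mx 1 : 'rV_#|vertex G|).
    rewrite -mulmxA (adjmx_mul_const _ _ reg) scalemxAr; congr (_ *m _).
    by apply/matrixP => i j; rewrite !mxE mulr1.
  rewrite xA -scalemxAl => /eqP; rewrite -subr_eq0 -scalerBl scaler_eq0.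
  by rewrite subr_eq0 (negbTE zk) => /eqP.
Qed.

Lemma degree_eigenvalue (R : realType) (G : digraph) k :
  k_regular G k -> is_eigenvalue (R := R) G k%:R.
Proof.
move=> reg; apply/eigenvalueP; exists (const_mx 1).
  rewrite (const_mul_adjmx _ _ reg).
  by apply/matrixP => i j; rewrite !mxE mulr1.
have /card_gt0P[v _] := vertex_nonempty G.
by apply/eqP => /matrixP/(_ 0 (enum_rank v)); rewrite !mxE => /eqP; rewrite oner_eq0.
Qed.

Lemma eigenvalue_le_degree (R : realType) (G : digraph) k (z : R[i]) :
  k_regular G k -> is_eigenvalue G z -> `|z| <= k%:R.
Proof.
move=> reg /eigenvalueP[x xA x0].
have [j xj] : exists j, x 0 j != 0.
  by apply/rV0Pn.
apply: (@eigen_modulus_le _ G k z (fun v => x 0 (enum_rank v)) (enum_val j)) => //.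
  by rewrite enum_valK.
by move=> v; rewrite -mulmx_adjmx xA mxE.
Qed.

Lemma perp_eigenvalue_conj (R : realType) (G : digraph) (z : R[i]) :
  perp_eigenvalue G z -> perp_eigenvalue G z^*.
Proof.
move=> [x [x0 xA x1]]; exists (map_mx conjc x); split.
- by rewrite map_mx_eq0.
- have -> : adjmx _ G = map_mx conjc (adjmx R[i] G).
    by apply/matrixP => i j; rewrite !mxE rmorph_nat.
  by rewrite -map_mxM xA map_mxZ.
- have -> : const_mx 1 = map_mx conjc (const_mx 1 : 'M[R[i]]_#|vertex G|).
    by rewrite map_const_mx rmorph1.
  by rewrite -map_mxM x1 map_mx0.
Qed.

Lemma perp_eigenvalue_swr (R : realType) (G : digraph) l lambda mu nu
    (z : R[i]) :
  swr_params G l lambda mu nu -> perp_eigenvalue G z ->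
  z ^+ l = (lambda%:R - mu%:R) * z + (nu%:R - mu%:R).
Proof.
move=> swr [x [x0 xA x1]].
have xAl : x *m (adjmx _ G ^+ l) = z ^+ l *: x.
  elim: l {swr} => [|l IHl]; first by rewrite !expr0 mulmx1 scale1r.
  by rewrite exprSr mulmxA IHl -scalemxAl xA scalerA exprSr.
apply/eqP; rewrite -subr_eq0.
suff : (z ^+ l - ((lambda%:R - mu%:R) * z + (nu%:R - mu%:R))) *: x == 0.
  by rewrite scaler_eq0 (negbTE x0) orbF.
rewrite scalerBl scalerDl -xAl (swr_adjmx_exp _ swr) !mulmxDr -!scalemxAr.
by rewrite xA x1 mulmx1 scaler0 addr0 scalerA subrr.
Qed.

(** * Growth of powers and the trinomial equation *)

(** Since [q] may be zero, the ratio is taken against the midpoint [p] of [q] and [rho]; Bernoulli's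
    inequality makes [(rho / p) ^+ l] exceed [|c| / d]. *)
Lemma geometric_domination (R : realType) (q rho c d : R) :
  0 <= q < rho -> 0 < d ->
  exists N, forall l, (N <= l)%N -> q ^+ l * c < rho ^+ l * d.
Proof.
move=> /andP[q0 qrho] d0.
have bernoulli (x : R) l : 0 <= x -> 1 + l%:R * x <= (1 + x) ^+ l.
  move=> x0; elim: l => [|l IHl]; first by rewrite mul0r addr0 expr0.
  rewrite exprS (le_trans _ (ler_wpM2l _ IHl)) ?addr_ge0//.
  rewrite -natr1; have : 0 <= (l%:R : R) by []; nra.
pose p := (q + rho) / 2; have p0 : 0 < p by rewrite /p; lra.
have [qp prho] : q <= p /\ p < rho by rewrite /p; lra.
pose x := rho / p - 1.
have x0 : 0 < x by rewrite subr_gt0 ltr_pdivlMr // mul1r.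
exists (Num.bound (`|c| / d / x)) => l Nl.
have rhoE : rho = p * (1 + x) by rewrite /x; field; rewrite gt_eqF.
have clt : `|c| < (1 + x) ^+ l * d.
  rewrite -ltr_pdivrMr // (lt_le_trans _ (bernoulli _ _ (ltW x0))) //.
  suff : `|c| / d < l%:R * x by lra.
  rewrite -ltr_pdivrMr //; apply: lt_le_trans (archi_boundP _) _.
    by rewrite !divr_ge0 ?(ltW d0) ?(ltW x0).
  by rewrite ler_nat.
rewrite rhoE exprMn -mulrA.
apply: (@le_lt_trans _ _ (p ^+ l * `|c|)); last by rewrite ltr_pM2l ?exprn_gt0.
rewrite (@le_trans _ _ (q ^+ l * `|c|)) //.
  by rewrite ler_wpM2l ?exprn_ge0 ?ler_norm.
by rewrite ler_wpM2r // lerXn2r ?nnegrE ?(ltW p0).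
Qed.

(* Lagrange interpolation: the affine map through (z1, z1^l) and (z2, z2^l)
   cannot reach z3^l once l is large. *)
Lemma affine_powers_bounded (R : realType) (z1 z2 z3 : R[i]) :
  z1 != z2 -> `|z1| < `|z3| -> `|z2| < `|z3| ->
  exists N, forall l a b, (N <= l)%N ->
    z1 ^+ l = a * z1 + b -> z2 ^+ l = a * z2 + b -> z3 ^+ l = a * z3 + b ->
    False.
Proof.
have normE (z : R[i]) : exists2 r : R, 0 <= r & `|z| = r%:C.
  by rewrite normc_def; eexists; last reflexivity; rewrite sqrtr_ge0.
move=> z12; have [r1 r10 z1E] := normE z1; have [r2 r20 z2E] := normE z2.
have [rho rho0 z3E] := normE z3; have [d d0 dE] := normE (z1 - z2).
have [c1 c10 c1E] := normE (z3 - z2); have [c2 c20 c2E] := normE (z3 - z1).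
rewrite z1E z2E z3E !ltcR => r1rho r2rho.
have dgt0 : 0 < d by rewrite -ltcR -dE normr_gt0 subr_eq0.
have qrho : 0 <= Num.max r1 r2 < rho by rewrite le_max r10 gt_max r1rho.
have [N dom] := geometric_domination (c1 + c2) qrho dgt0.
exists N => l a b /dom; rewrite ltNge => /negP nle e1 e2 e3; apply: nle.
have interp : z3 ^+ l * (z1 - z2) = z1 ^+ l * (z3 - z2) - z2 ^+ l * (z3 - z1).
  by rewrite e1 e2 e3; ring.
rewrite mulrDr -lecR.
have -> : (rho ^+ l * d)%:C = `|z3 ^+ l * (z1 - z2)|.
  by rewrite normrM normrX z3E dE !rmorphM rmorphXn.
rewrite interp (le_trans (ler_normB _ _)) // !normrM !normrX c1E c2E z1E z2E.
rewrite -!rmorphXn -!rmorphM -rmorphD lecR lerD // ler_wpM2r //.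
  by rewrite lerXn2r ?nnegrE ?le_max ?r10 ?lexx.
by rewrite lerXn2r ?nnegrE ?le_max ?r10 ?lexx ?orbT.
Qed.

(* The circle |z| = r meets each circle centred at the nonzero real point
   - b / a in at most one conjugate pair. *)
Lemma trinomial_equimodular (R : rcfType) (a b : R) l (z w : R[i]) :
  a != 0 -> b != 0 ->
  z ^+ l = a%:C * z + b%:C -> w ^+ l = a%:C * w + b%:C ->
  `|z| = `|w| -> z = w \/ z = w^*.
Proof.
move=> a0 b0 ez ew zw.
have : `|a%:C * z + b%:C| = `|a%:C * w + b%:C|.
  by rewrite -ez -ew !normrX zw.
move=> /(congr1 (fun x => x ^+ 2)); move/(congr1 (fun x => x ^+ 2)): zw.
rewrite -!add_Re2_Im2 => /complexI nzw /complexI.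
case: z w nzw {ez ew} => [x y] [u v] /= nzw; rewrite !mul0r !subr0 !addr0 => nab.
have xu : x = u.
  (* Expanding the squared moduli, the quadratic terms cancel and [2 a b x = 2 a b u] remains. *)
  apply: (mulfI (mulf_neq0 a0 b0)); nra.
rewrite xu in nzw *; have : (y - v) * (y + v) = 0 by nra.
move/eqP; rewrite mulf_eq0 subr_eq0 addr_eq0 => /orP[] /eqP ->; by [left|right].
Qed.

(** * From the trinomial to a quadratic matrix equation *)

(** In a rank factorisation [Q = C R], cancelling [C] and [R] in [C R C R = C R] leaves [R C = 1],
    whose trace is the rank. *)
Lemma mxtrace_idempotent (F : fieldType) n (Q : 'M[F]_n) :
  Q *m Q = Q -> \tr Q = (\rank Q)%:R.
Proof.
move=> QQ; rewrite -{1}(mulmx_base Q) mxtrace_mulC.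
suff -> : row_base Q *m col_base Q = 1%:M by rewrite mxtrace1.
apply: (row_free_inj (row_base_free Q)).
apply: (row_full_inj (col_base_full Q)).
by rewrite mul1mx -mulmxA mulmxA mulmx_base QQ.
Qed.

(** Apply the linear factors of [g] one by one: the last nonzero vector is an eigenvector. Its form
    [y q(A)] keeps it in every [A]-stable subspace containing [y]. *)
Lemma annihilated_eigenvector (F : closedFieldType) n (A : 'M[F]_n.+1)
    (y : 'rV_n.+1) (g : {poly F}) :
  g != 0 -> y != 0 -> y *m horner_mx A g = 0 ->
  exists q z, let x := y *m horner_mx A q in
    [/\ root g z, x != 0 & x *m A = z *: x].
Proof.
have [rs gE] := closed_field_poly_normal g.
rewrite -lead_coef_eq0 {2}gE => c0.
have {gE} rootg z : z \in rs -> root g z.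
  by move=> zrs; rewrite gE rootZ // root_prod_XsubC.
elim: rs y rootg => [|z rs IHrs] y rootg y0.
  rewrite big_nil alg_polyC horner_mx_C mul_mx_scalar => /eqP.
  by rewrite scaler_eq0 (negbTE c0) (negbTE y0).
rewrite big_cons scalerAr rmorphM /= mulmxA.
have AzE : horner_mx A ('X - z%:P) = A - z%:M.
  by rewrite rmorphB /= horner_mx_X horner_mx_C.
have [yz0 _|yz0] := eqVneq (y *m horner_mx A ('X - z%:P)) 0.
  exists 1, z; rewrite rmorph1 mulmx1; split=> //.
    by rewrite rootg ?mem_head.
  by apply/eqP; rewrite -subr_eq0 -mul_mx_scalar -mulmxBr -AzE yz0.
move=> /(IHrs _ _ yz0)[w wrs|q [x [rx x0 xA]]].
  by rewrite rootg // in_cons wrs orbT.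
by exists (('X - z%:P) * q), x; rewrite rmorphM /= mulmxA; split.
Qed.

(* The cofactor of (X - z)(X - w) in the annihilating trinomial has no root
   among the eigenvalues, so it acts injectively. *)
Lemma trinomial_quadratic (F : closedFieldType) n (A J : 'M[F]_n) k l a b z w :
  A *m J = k *: J ->
  (forall x : 'rV_n, x *m J = 0 -> x *m (A ^+ l) = a *: (x *m A) + b *: x) ->
  (forall (x : 'rV_n) t, x != 0 -> x *m J = 0 -> x *m A = t *: x ->
    t = z \/ t = w) ->
  z != w -> z ^+ l = a * z + b -> w ^+ l = a * w + b ->
  z ^+ l.-1 *+ l != a -> w ^+ l.-1 *+ l != a ->
  forall x : 'rV_n, x *m J = 0 -> x *m A *m A = (z + w) *: (x *m A) - (z * w) *: x.
Proof.
case: n A J => [|n] A J AJ xAl eig zw ez ew z1 w1 x xJ.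
  by apply/matrixP => i [].
pose f : {poly F} := 'X^l - a *: 'X - b%:P.
have fE t : f.[t] = t ^+ l - a * t - b by rewrite !hornerE.
have f'E t : f^`().[t] = t ^+ l.-1 *+ l - a.
  by rewrite !derivE subr0 hornerD hornerMn !hornerE.
have /factor_theorem[q fq] : root f z by rewrite rootE fE ez [_ + b]addrC addrK subrr.
have /factor_theorem[g qg] : root q w.
  have /eqP : f.[w] = 0 by rewrite fE ew [_ + b]addrC addrK subrr.
  by rewrite fq hornerM hornerXsubC mulf_eq0 subr_eq0 [w == z]eq_sym (negbTE zw) orbF.
(* If [g] vanished at [z], then [z] would be a double root of [f], against the derivative
   hypothesis; likewise for [w]. *)
have gz : g.[z] != 0.
  apply: contraNneq z1 => gz0; rewrite -subr_eq0 -f'E fq qg !derivM !derivXsubC.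
  by rewrite !hornerE gz0 subrr !(mul0r, mulr0, addr0).
have gw : g.[w] != 0.
  apply: contraNneq w1 => gw0; rewrite -subr_eq0 -f'E fq qg !derivM !derivXsubC.
  by rewrite !hornerE gw0 subrr !(mul0r, mulr0, addr0).
(* Hence the row vectors killed by [J] are stable under polynomials in [A]. *)
have hJ p : horner_mx A p *m J = p.[k] *: J.
  elim/poly_ind: p => [|p c IHp]; first by rewrite rmorph0 mul0mx horner0 scale0r.
  rewrite rmorphD rmorphM /= horner_mx_X horner_mx_C mulmxDl -mulmxA AJ.
  by rewrite -scalemxAr IHp mul_scalar_mx !hornerE scalerA scalerDl mulrC.
pose p := ('X - w%:P) * ('X - z%:P).
have pE : x *m horner_mx A p = x *m A *m A - (z + w) *: (x *m A) + (z * w) *: x.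
  rewrite rmorphM /= !rmorphB /= horner_mx_X !horner_mx_C mulmxA.
  rewrite !mulmxBr !mul_mx_scalar mulmxBl -scalemxAl scalerBr scalerA opprB.
  by rewrite scalerDl opprD -!addrA; congr (_ + _);
    rewrite [LHS]addrA [LHS]addrC.
apply/eqP; rewrite -subr_eq0 opprB addrA addrAC -pE.
apply: contraT => y0.
have g0 : g != 0 by apply: contraNneq gz => ->; rewrite horner0.
have [|r [t [gt u0 uA]]] := annihilated_eigenvector (A := A) g0 y0.
  have -> : x *m horner_mx A p *m horner_mx A g = x *m horner_mx A f.
    by rewrite fq qg -mulrA [g * _]mulrC (rmorphM _ p g) mulmxA.
  rewrite !rmorphB /= rmorphXn /=
    linearZ /= horner_mx_X horner_mx_C mulmxBr mulmxBr xAl //.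
  by rewrite -scalemxAr mul_mx_scalar -[LHS]addrA -opprD subrr.
have uJ : x *m horner_mx A p *m horner_mx A r *m J = 0.
  by rewrite -!mulmxA hJ -scalemxAr hJ -!scalemxAr xJ !scaler0.
by case: (eig _ t u0 uJ uA) gt => ->; rewrite rootE (negbTE gz, negbTE gw).
Qed.

Lemma sqr_const_mx (F : pzSemiRingType) n :
  (const_mx 1 : 'M[F]_n) *m const_mx 1 = n%:R *: const_mx 1 :> 'M_n.
Proof.
apply/matrixP => i j; rewrite !mxE mulr1 (eq_bigr (fun=> 1)).
  by rewrite sumr_const card_ord.
by move=> ? _; rewrite !mxE mulr1.
Qed.

(** The rows of the projection [P = 1 - J / n] are killed by [J], so the hypothesis applies to each
    of them; [J A = k J] then fixes the coefficient of [J]. *)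
Lemma quadratic_of_perp (F : fieldType) n (A : 'M[F]_n) k s d :
  let J := const_mx 1 in
  n%:R != 0 :> F -> A *m J = k *: J -> J *m A = k *: J ->
  (forall x : 'rV_n, x *m J = 0 ->
    x *m A *m A = s *: (x *m A) - d *: x) ->
  A *m A = s *: A - d *: 1%:M + ((k ^+ 2 - s * k + d) / n%:R) *: J.
Proof.
move=> J n0 AJ JA quad.
pose P : 'M[F]_n := 1%:M - n%:R^-1 *: J.
have PJ : P *m J = 0.
  by rewrite mulmxBl mul1mx -scalemxAl sqr_const_mx scalerA mulVf ?scale1r ?subrr.
have PA : P *m A *m A = s *: (P *m A) - d *: P.
  apply/row_matrixP => i; rewrite !row_mul quad; last by rewrite -row_mul PJ row0.
  have rowB (X Y : 'M[F]_n) : row i (s *: X - d *: Y) = s *: row i X - d *: row i Y.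
    by rewrite linearB /= !linearZ.
  by rewrite rowB row_mul.
move: PA; rewrite !mulmxBl !mul1mx -!scalemxAl JA -!scalemxAl JA scalerA.
move/eqP; rewrite subr_eq => /eqP ->; rewrite !scalerBr !scalerA.
rewrite opprB addrA [in RHS]mulrDl scalerDl [in RHS]mulrBl scalerBl.
apply/matrixP => i j; rewrite !mxE; ring.
Qed.

(** [Q] is the projection onto the [z]-eigenspace: [(A - w) / (z - w)], corrected by the multiple of
    [J] that makes it kill the all-ones vector. Its trace is its rank [m]. *)
Lemma quadratic_trace (F : fieldType) n (A : 'M[F]_n) k z w :
  let J := const_mx 1 in
  n%:R != 0 :> F -> z != w -> A *m J = k *: J -> J *m A = k *: J ->
  \tr A = 0 ->
  A *m A = (z + w) *: A - (z * w) *: 1%:M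
    + ((k ^+ 2 - (z + w) * k + z * w) / n%:R) *: J ->
  exists m : nat, - k - w * (n%:R - 1) = m%:R * (z - w).
Proof.
move=> J n0 zw AJ JA trA AA.
have JJ : J *m J = n%:R *: J by exact: sqr_const_mx.
have zw0 : z - w != 0 by rewrite subr_eq0.
pose u := (z - w)^-1.
pose Q : 'M[F]_n := u *: (A - w *: 1%:M) - ((k - w) * u / n%:R) *: J.
exists (\rank Q); rewrite -mxtrace_idempotent.
  rewrite /Q linearB /= !mxtraceZ linearB /= mxtraceZ trA mxtrace1.
  have -> : \tr J = n%:R.
    by rewrite /mxtrace (eq_bigr (fun=> 1)) ?sumr_const ?card_ord // => i _; rewrite mxE.
  by rewrite /u; field; rewrite zw0 n0.
rewrite /Q !(mulmxBl, mulmxBr) -!(scalemxAl, scalemxAr) !(mulmxBl, mulmxBr).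
rewrite -!(scalemxAl, scalemxAr) !mul1mx !mulmx1 AJ JA JJ AA.
apply/matrixP => i j; rewrite !mxE /u; field.
by rewrite zw0 n0.
Qed.

(** * Counting 2-walks to recognise a tournament *)

(** Here [n] is the number of vertices minus one, and [a], [b], [t] count the 2-walks along an edge,
    between distinct nonadjacent vertices, and from a vertex to itself. As [0 < k < n], the integer
    [b - a = 2 k / n] lies strictly between 0 and 2, so it is 1. The last equation becomes
    [t = k (k + 1 - 2 b)]; a positive [t] would give [t >= k] and [2 b <= k], against [t < b]. *)
Lemma tournament_arithmetic n k a b t :
  (a * n + 2 * k = b * n)%N -> (0 < k < n)%N -> (t < b)%N ->
  (b * n.+1 + a * k + t = k ^ 2 + b * k + b)%N -> n = (2 * k)%N /\ t = 0%N.
Proof.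
move=> en /andP[k0 kn] tb eb.
have bE : b = a.+1 by nia.
have nE : n = (2 * k)%N by nia.
split=> //; apply/eqP; rewrite -leqn0 leqNgt; apply/negP => t0.
have kb : (2 * b < k.+1)%N by nia.
nia.
Qed.

Lemma nwalks2_diag0 (G : digraph) (u v : vertex G) :
  nwalks 2 u u = 0%N -> edge u v -> ~~ edge v u.
Proof.
move=> w0 euv; apply/negP => evu.
have := nwalksE nat 2 u u; rewrite w0 expr2 (adjmx_mulmx (adjmx nat G) u).
move=> /esym/eqP; rewrite natn sum_nat_eq0 => /forallP/(_ v).
by rewrite euv mxE !enum_rankK evu.
Qed.

(** If all ordered pairs of distinct vertices were edges, then [A = J - 1] would act as [-1] on
    vectors with zero entry sum. *)
Lemma nonedge_of_nonreal (R : realType) (G : digraph) (z : R[i]) :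
  perp_eigenvalue G z -> z \isn't Num.real ->
  exists u v : vertex G, u != v /\ ~~ edge u v.
Proof.
move=> [x [x0 xA x1]] znr.
have [/existsP[u /existsP[v /andP[]]]|] :=
  boolP [exists u : vertex G, exists v : vertex G, (u != v) && ~~ edge u v].
  by exists u, v.
rewrite negb_exists => /forallP full; have [j xj] := rV0Pn _ x0.
case/negP: znr; suff -> : z = -1 by rewrite rpredN rpred1.
have := mulmx_adjmx x (enum_val j) 0.
rewrite xA mxE enum_valK.
rewrite (eq_bigl (fun u => u != enum_val j)) => [|u]; last first.
  have := full u; rewrite negb_exists => /forallP/(_ (enum_val j)).
  rewrite negb_and !negbK; case: eqVneq => [->|_ /= ->] //.
  by rewrite edge_irrefl.
move/matrixP/(_ 0 j): x1; rewrite !mxE.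
rewrite (eq_bigr (fun i => x 0 (enum_rank (enum_val i)))); last first.
  by move=> i _; rewrite mxE mulr1 enum_valK.
rewrite -(big_enum_val (fun u => x 0 (enum_rank u))) /=.
rewrite (bigD1 (enum_val j)) //= enum_valK => /eqP.
rewrite addrC addr_eq0 => /eqP -> zx; apply: (mulIf xj).
by rewrite zx mulN1r.
Qed.

Lemma tournament_of_quadratic (R : realType) (G : digraph) k (z : R[i]) :
  strongly_connected G -> k_regular G k -> perp_eigenvalue G z ->
  z \isn't Num.real ->
  (forall x : 'rV_#|vertex G|, x *m const_mx 1 = 0 :> 'rV_#|vertex G| ->
    x *m adjmx _ G *m adjmx _ G
    = (z + z^*) *: (x *m adjmx _ G) - (z * z^*) *: x) ->
  doubly_regular_tournament G.
Proof.
move=> sc reg zE znr quad.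
have n0 : #|vertex G|%:R != 0 :> R[i].
  by rewrite pnatr_eq0 -lt0n vertex_nonempty.
have AJ : adjmx R[i] G *m const_mx 1 = k%:R *: const_mx 1 :> 'M_#|vertex G|.
  by rewrite (adjmx_mul_const _ _ reg); apply/matrixP => i j; rewrite !mxE mulr1.
have JA : const_mx 1 *m adjmx R[i] G = k%:R *: const_mx 1 :> 'M_#|vertex G|.
  by rewrite (const_mul_adjmx _ _ reg); apply/matrixP => i j; rewrite !mxE mulr1.
have zz : z != z^*.
  case: z znr {zE quad} => a b; rewrite complex_real eq_complex /= eqxx /=.
  by apply: contraNneq => bN; apply/eqP; lra.
have AA := quadratic_of_perp n0 AJ JA quad.
have trA : \tr (adjmx R[i] G) = 0.
  by apply: big1 => i _; rewrite mxE edge_irrefl.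
have [m tr1] := quadratic_trace n0 zz AJ JA trA AA.
set c := (_ / _) in AA.
(* Adding the conjugate identity eliminates [m] and leaves [(z + z^* ) (n - 1) = - 2 k]. *)
have tr2 := congr1 conjc tr1.
rewrite !(rmorphM, rmorphB, rmorphN, rmorph1, rmorph_nat) /= conjcK in tr2.
have d0 : 0 < z * z^*.
  rewrite -sqr_normc exprn_gt0 // normr_gt0.
  by apply: contraNneq znr => ->; rewrite rpred0.
have entry (u v : vertex G) : (nwalks 2 u v)%:R
    = (z + z^*) * (edge u v)%:R - z * z^* * (u == v)%:R + c.
  have -> : (nwalks 2 u v)%:R
      = (adjmx R[i] G *m adjmx _ G) (enum_rank u) (enum_rank v).
    exact: (nwalksE R[i] 2 u v).
  rewrite AA !mxE !enum_rankK (inj_eq enum_rank_inj).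
  by rewrite mulr1.
(* A nonadjacent pair exhibits [c] as a walk count, and an edge does the same for [z + z^* + c]; the
   identities can then be read in the natural numbers. *)
have [u1 [v1 [uv1 ne1]]] := nonedge_of_nonreal zE znr.
have ent1 := entry u1 v1; rewrite (negbTE uv1) (negbTE ne1) in ent1.
have diag u := entry u u.
have k0 : (0 < k)%N.
  rewrite lt0n; apply: contraNneq znr => k0.
  have := eigenvalue_le_degree reg ((perp_eigenvalueP z sc reg).1 zE).1.
  by rewrite k0 normr_le0 => /eqP ->; rewrite rpred0.
have [v0 ev0] : exists v0, edge u1 v0.
  have := (reg u1).2 => k1; move: k0; rewrite -k1 => /card_gt0P[v0].
  by rewrite inE; exists v0.
have ent0 := entry u1 v0; rewrite ev0 in ent0.
have nu0 : (u1 == v0) = false.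
  by apply: contraTF ev0 => /eqP <-; rewrite edge_irrefl.
rewrite nu0 in ent0.
have diag1 := diag u1; rewrite edge_irrefl eqxx in diag1.
have nE : #|vertex G| = #|vertex G|.-1.+1 by rewrite prednK ?vertex_nonempty.
have [nk t0] : #|vertex G|.-1 = (2 * k)%N /\ nwalks 2 u1 u1 = 0%N.
  have nR : #|vertex G|%:R = #|vertex G|.-1%:R + 1 :> R[i].
    by rewrite {1}nE -natr1.
  apply: (@tournament_arithmetic _ _ (nwalks 2 u1 v0) (nwalks 2 u1 v1)).
  - apply/eqP; rewrite -(eqr_nat R[i]) !natrD !natrM ent0 ent1.
    have tr : (z + z^*) * (#|vertex G|.-1%:R) + 2 * k%:R = 0 :> R[i].
      rewrite nR addrK in tr1 tr2; apply/eqP; rewrite -oppr_eq0; apply/eqP.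
      transitivity (m%:R * (z - z^*) + m%:R * (z^* - z)); last by ring.
      by rewrite -tr1 -tr2; ring.
    rewrite -subr_eq0; apply/eqP; rewrite -[RHS]tr /=; ring.
  (* The out-neighbourhood of [u1] misses both [u1] and [v1]. *)
  - rewrite k0 /= -ltnS -nE -(reg u1).2.
    have : [set w | edge u1 w] \subset ~: [set u1; v1].
      apply/fintype.subsetP => w; rewrite !inE => euw; apply/norP; split.
        by apply: contraTneq euw => ->; rewrite edge_irrefl.
      by apply: contraTneq euw => ->.
    move=> /subset_leq_card; rewrite (cardsCs (~: _)) finset.setCK cards2 uv1.
    by have := max_card [set u1; v1]; rewrite cards2 uv1; lia.
  (* The difference of the two counts is [z z^*], which is positive. *)
  - rewrite -(ltr_nat R[i]) diag1 ent1 !mulr1 !mulr0 -subr_gt0.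
    by move: d0; rewrite oppr0 !add0r opprD opprK addrCA subrr addr0.
  - have cE : c * #|vertex G|%:R = k%:R ^+ 2 - (z + z^*) * k%:R + z * z^*.
      by rewrite /c mulfVK.
    apply/eqP; rewrite -(eqr_nat R[i]) -nE !natrD natrX !natrM ent0 ent1 diag1 /=
      !mulr0 subr0 add0r cE.
    apply/eqP; ring.
have dig (u v : vertex G) : edge u v -> ~~ edge v u.
  apply: nwalks2_diag0; apply/eqP; rewrite -(eqr_nat R[i]) diag edge_irrefl eqxx.
  by rewrite -diag1 t0.
(* Without digons, the in- and out-neighbourhoods of [u] are disjoint; their [2 k = n - 1] elements
   exhaust the other vertices. *)
have tour (u v : vertex G) : u != v -> ~~ edge u v -> edge v u.
  move=> uv neuv.
  pose O := [set w | edge u w]; pose I := [set w | edge w u].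
  have OI : [disjoint O & I].
    by rewrite -finset.setI_eq0; apply/eqP/finset.setP => w; rewrite !inE; apply/negP => /andP[/dig/negP].
  have cOI : #|O :|: I| = (2 * k)%N.
    have [_] := leq_card_setU O I; rewrite OI => /eqP ->.
    by rewrite /O /I (reg u).1 (reg u).2 mul2n addnn.
  have sub : O :|: I \subset [set~ u].
    by apply/fintype.subsetP => w; rewrite !inE; apply: contraTneq => ->; rewrite edge_irrefl.
  have /eqP eq : O :|: I == [set~ u].
    by rewrite eqEcard sub cOI cardsC1 nk leqnn.
  by have := finset.in_setC1 v u; rewrite -eq !inE (negbTE neuv) eq_sym uv.
split; first by exists k.
  apply/matrixP => i j; rewrite !mxE.
  case: eqVneq => [->|ij]; first by rewrite edge_irrefl subrr.
  have vij : enum_val i != enum_val j by rewrite (inj_eq enum_val_inj).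
  case: (boolP (edge (enum_val i) _)) => [/dig/negbTE -> //|/(tour _ _ vij) ->].
  by rewrite add0r subr0.
exists (nwalks 2 u1 v0)%:Z, (nwalks 2 u1 v1)%:Z.
apply/matrixP => i j; rewrite -(enum_valK i) -(enum_valK j) -nwalksE !mxE.
rewrite !enum_rankK (inj_eq enum_rank_inj) natz.
move: (enum_val i) (enum_val j) => u v.
case: (eqVneq u v) => [->|uv].
  rewrite edge_irrefl /= !(subrr, subr0, mulr0, addr0); congr Posz; apply/eqP.
  by rewrite -(eqr_nat R[i]) diag edge_irrefl eqxx -diag1 t0.
case: (boolP (edge u v)) => [euv|neuv] /=.
  rewrite subr0 subrr mulr0 addr0 mulr1; congr Posz; apply/eqP.
  by rewrite -(eqr_nat R[i]) entry ent0 euv (negbTE uv).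
rewrite !subr0 mulr0 add0r mulr1; congr Posz; apply/eqP.
by rewrite -(eqr_nat R[i]) entry ent1 (negbTE neuv) (negbTE uv).
Qed.

(** * Polar form, simple roots and the final case analysis *)

Lemma expi_polar (R : realType) (z : R[i]) :
  exists rho phi : R, [/\ `|z| = rho%:C, z = rho%:C * expi phi
    & z^* = rho%:C * expi (- phi)].
Proof.
have polar (x y : R) : exists phi,
    x +i* y = (Num.sqrt (x ^+ 2 + y ^+ 2))%:C * expi phi.
  set r := Num.sqrt _; have r0 : 0 <= r by exact: sqrtr_ge0.
  have r2 : r ^+ 2 = x ^+ 2 + y ^+ 2 by rewrite sqr_sqrtr ?addr_ge0 ?sqr_ge0.
  have [rz|rnz] := eqVneq r 0.
    exists 0; rewrite rz mul0r; move/esym/eqP: r2; rewrite rz expr0n /=.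
    by rewrite paddr_eq0 ?sqr_ge0 // !sqrf_eq0 => /andP[/eqP-> /eqP->].
  have rgt : 0 < r by rewrite lt_neqAle eq_sym rnz.
  have xr : -1 <= x / r <= 1.
    rewrite ler_pdivlMr // ler_pdivrMr // mulN1r mul1r -ler_norml.
    by rewrite -sqrtr_sqr /r ler_wsqrtr // lerDl sqr_ge0.
  have cosE : r * cos (acos (x / r)) = x.
    by rewrite acosK ?in_itv //= mulrC divfK.
  have sinE : r * sin (acos (x / r)) = `|y|.
    rewrite sin_acos // -[LHS]ger0_norm ?mulr_ge0 ?sqrtr_ge0 //.
    apply/eqP; rewrite -(eqrXn2 (n := 2)) ?normr_ge0 // !real_normK ?num_real //.
    rewrite exprMn (@sqr_sqrtr _ (1 - _)); last first.
      by rewrite subr_ge0 -real_normK ?num_real // expr_le1 ?normr_ge0 // ler_norml.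
    by rewrite mulrBr -exprMn mulrC [r * _]mulrC divfK // r2; apply/eqP; ring.
  (* [acos] only reaches angles with nonnegative sine, so the sign of [y] decides the sign of
     [phi]. *)
  have [y0|y0] := leP 0 y.
    exists (acos (x / r)); apply/eqP; rewrite eq_complex /= !mul0r subr0 addr0.
    by rewrite cosE sinE ger0_norm // !eqxx.
  exists (- acos (x / r)); apply/eqP; rewrite eq_complex /= !mul0r subr0 addr0.
  by rewrite cosN sinN mulrN cosE sinE ltr0_norm // opprK !eqxx.
case: z => x y; have [phi zE] := polar x y.
exists (Num.sqrt (x ^+ 2 + y ^+ 2)), phi; split=> //.
by rewrite zE rmorphM /= oppr0 /expi cosN sinN.
Qed.

Lemma infinite_set_unbounded (A : set nat) N :
  infinite_set A -> exists2 l, A l & (N <= l)%N.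
Proof.
move=> Ainf; apply: contrapT => none; apply: Ainf.
apply: sub_finite_set (finite_II N) => l Al /=.
by rewrite ltnNge; apply/negP => Nl; apply: none; exists l.
Qed.

(** At a multiple root, [l z^(l-1) = a] multiplied by [z] and combined with the trinomial gives
    [a (l - 1) z = - b l], so [z] is real. *)
Lemma trinomial_simple_root (R : rcfType) (a b : R) l (z : R[i]) :
  (1 < l)%N -> a != 0 -> z \isn't Num.real -> z ^+ l = a%:C * z + b%:C ->
  z ^+ l.-1 *+ l != a%:C.
Proof.
move=> l1 a0 znr zE; apply: contraNneq znr => zl.
have c0 : a * (l%:R - 1) != 0.
  by rewrite mulf_neq0 // subr_eq0 (eqr_nat _ l 1) gtn_eqF.
have lin : (a * (l%:R - 1))%:C * z = (- (b * l%:R))%:C.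
  have : z ^+ l.-1 *+ l * z = z ^+ l *+ l.
    by rewrite mulrnAl -exprSr prednK // ltnW.
  rewrite zl zE -mulr_natr => azE; apply/eqP; rewrite -subr_eq0; apply/eqP.
  rewrite -[RHS](subrr (a%:C * z)) [X in _ = X - _]azE.
  by rewrite rmorphN !rmorphM rmorphB rmorph1 rmorph_nat /=; ring.
apply/complex_realP; exists (- (b * l%:R) / (a * (l%:R - 1))).
rewrite fmorph_div /= -lin mulrC mulKf //.
by rewrite fmorph_eq0.
Qed.

Theorem theorem7p2 (R : realType) (G : digraph)
  (Gsc : strongly_connected G) (Greg : regular G)
  (Gnonreal : exists z : R[i], is_eigenvalue G z /\ z \isn't Num.real)
  (Ginf : infinite_set [set l : nat | strongly_walk_regular G l]%classic) :
  doubly_regular_tournament G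
  \/ (forall l lambda mu nu : nat, (1 < l)%N ->
        swr_params G l lambda mu nu -> mu = lambda \/ mu = nu)
  \/ (exists (k : nat) (rho phi theta : R),
        let ev := [:: k%:R; rho%:C * expi phi; rho%:C * expi (- phi); theta%:C] in
        [/\ k_regular G k, uniq ev,
            forall z : R[i], is_eigenvalue G z <-> z \in ev
          & 0 < `|theta| < rho /\ rho <= k%:R]).
Proof.
have [k reg] := Greg; have [z [zev znr]] := Gnonreal.
have [ii|nii] := EM (forall l lambda mu nu : nat, (1 < l)%N ->
  swr_params G l lambda mu nu -> mu = lambda \/ mu = nu); first by right; left.
have perpP w := perp_eigenvalueP w Gsc reg.
have zE : perp_eigenvalue G z.
  by apply/perpP; split=> //; apply: contraNneq znr => ->; rewrite realn.
have zcE := perp_eigenvalue_conj zE.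
have zz : z != z^*.
  case: z znr {zev zE zcE} => x y; rewrite complex_real eq_complex /= eqxx /=.
  by apply: contraNneq => yN; apply/eqP; lra.
have zcnr : z^* \isn't Num.real.
  by case: z znr {zev zE zcE zz} => x y; rewrite !complex_real oppr_eq0.
(* The failure of (ii) provides one exponent whose trinomial has both coefficients nonzero. *)
have [l [la [mu [nu [l1 swr mula munu]]]]] : exists l la mu nu,
    [/\ (1 < l)%N, swr_params G l la mu nu, mu != la & mu != nu].
  apply: contrapT => none; apply: nii => l la mu nu l1 swr.
  have [->|mula] := eqVneq mu la; [by left|right].
  have [//|munu] := eqVneq mu nu.
  by case: none; exists l, la, mu, nu.
pose a : R := la%:R - mu%:R; pose b : R := nu%:R - mu%:R.
have a0 : a != 0 by rewrite subr_eq0 eqr_nat eq_sym.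
have b0 : b != 0 by rewrite subr_eq0 eqr_nat eq_sym.
have aE : la%:R - mu%:R = a%:C :> R[i] by rewrite rmorphB !rmorph_nat.
have bE : nu%:R - mu%:R = b%:C :> R[i] by rewrite rmorphB !rmorph_nat.
have tri w : perp_eigenvalue G w -> w ^+ l = a%:C * w + b%:C.
  by move=> /(perp_eigenvalue_swr swr) ->; rewrite aE bE.
(* Only here does the infinite supply of exponents enter: one is taken beyond the interpolation
   bound. *)
have no_two_below (z1 z2 z3 : R[i]) : perp_eigenvalue G z1 ->
    perp_eigenvalue G z2 -> perp_eigenvalue G z3 ->
    z1 != z2 -> `|z1| < `|z3| -> `|z2| < `|z3| -> False.
  move=> E1 E2 E3 z12 lt1 lt2.
  have [N bounded] := affine_powers_bounded z12 lt1 lt2.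
  have [l' [_ [la' [mu' [nu' swr']]]] Nl'] := infinite_set_unbounded N Ginf.
  by apply: (bounded _ _ _ Nl'); apply: (perp_eigenvalue_swr swr').
(* A larger modulus would put both [z] and [z^*] below [w]; an equal one makes [w] one of them. *)
have below w : perp_eigenvalue G w -> w != z -> w != z^* -> `|w| < `|z|.
  move=> wE wz wzc.
  case: (real_ltgtP (normr_real w) (normr_real z)) => // [zw|wzn].
    by case: (@no_two_below z z^* w) => //; rewrite normcJ.
  have [eq|eq] := trinomial_equimodular a0 b0 (tri _ wE) (tri _ zE) wzn.
    by rewrite eq eqxx in wz.
  by rewrite eq eqxx in wzc.
have [[w [wE wz wzc]]|none] :=
  EM (exists w, [/\ perp_eigenvalue G w, w != z & w != z^*]); last first.
  have only w : perp_eigenvalue G w -> w = z \/ w = z^*.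
    move=> wE; have [->|wz] := eqVneq w z; [by left|right].
    have [//|wzc] := eqVneq w z^*.
    by case: none; exists w.
  left; apply: (tournament_of_quadratic Gsc reg zE znr).
  have AJ : adjmx R[i] G *m const_mx 1 = k%:R *: const_mx 1 :> 'M_#|vertex G|.
    by rewrite (adjmx_mul_const _ _ reg); apply/matrixP => i j; rewrite !mxE mulr1.
  apply: (trinomial_quadratic AJ _ _ zz (tri _ zE) (tri _ zcE)).
  - move=> x xJ; have -> := swr_adjmx_exp R[i] swr.
    by rewrite !mulmxDr -!scalemxAr xJ scaler0 addr0 mulmx1 aE bE.
  - by move=> x t x0 xJ xA; apply: only; exists x.
  - exact: trinomial_simple_root (tri _ zE).
  - exact: trinomial_simple_root (tri _ zcE).
have wlt := below w wE wz wzc.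
(* Otherwise [w] and [w^*] would be two elements below [z]. *)
have wreal : w^* = w.
  apply/eqP; apply: contraT => wcw.
  by case: (@no_two_below w^* w z) => //; rewrite ?normcJ //; apply: perp_eigenvalue_conj.
have only v : perp_eigenvalue G v -> v \in [:: z; z^*; w].
  move=> vE; rewrite !inE.
  have [//|vz] := eqVneq v z; have [//|vzc] := eqVneq v z^*.
  by apply: contraT => /= vw; case: (@no_two_below v w z) => //; apply: below.
have [theta wth] : exists theta : R, w = theta%:C.
  apply/complex_realP; case: w wreal {wE wz wzc wlt only} => x y [yN].
  by rewrite complex_real; apply/eqP; lra.
have [rho [phi [rhoE zpol zcpol]]] := expi_polar z.
right; right; exists k, rho, phi, theta; rewrite /= -zpol -zcpol -wth.
have zk v : perp_eigenvalue G v -> k%:R != v.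
  by move=> /perpP[_]; rewrite eq_sym.
split; first exact: reg.
- rewrite !inE !negb_or !zk //= zz /= ![_ == w]eq_sym wz wzc //.
- move=> v; rewrite in_cons; split=> [vev|].
    by have [//|vk] := eqVneq v k%:R; apply: only; apply/perpP.
  case/orP=> [/eqP->|]; first exact: degree_eigenvalue.
  by rewrite !inE => /or3P[] /eqP->; [have /perpP[] := zE
    | have /perpP[] := zcE | have /perpP[] := wE].
- have := eigenvalue_le_degree reg zev.
  have kE : k%:R = k%:R%:C :> R[i] by rewrite rmorph_nat.
  rewrite rhoE kE lecR => rk; split; last exact: rk.
  apply/andP; split.
    (* If [theta] were 0, the trinomial at 0 would give [b = 0]. *)
    rewrite normr_gt0; apply: contraNneq b0 => th0.
    have := tri w wE; rewrite wth th0 expr0n gtn_eqF ?(ltnW l1) // mulr0 add0r.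
    by move=> /complexI <-.
  move: wlt; rewrite rhoE wth normc_def /= expr0n /= addr0 sqrtr_sqr ltcR; exact.
Qed.
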